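(* Let $\mu_0\in\mathbb{W}_2(\mathbb{R}^m)$ be absolutely continuous. Given $\{\theta_i\}_{i=1}^N\subset\Theta\subset\mathbb{R}^m_+$ and the corresponding measures $\{\mu_{\theta_i}\}_{i=1}^N\subset\mathcal{M}^{\mathrm{dil}}(\mu_0,\Theta)$, the Functional Wassmap algorithm with exponent $2$ and embedding dimension $m$, applied to $\{\mu_{\theta_i}\}_{i=1}^N$, recovers $\{S\theta_i\}_{i=1}^N\subset\mathbb{R}^m$ up to rigid transformation, where $S$ is the diagonal matrix $$S=\mathrm{diag}\big(M_2^{1/2}(P_1\mu_0),\dots,M_2^{1/2}(P_m\mu_0)\big).$$
   Context: $\mathbb{W}_2(\mathbb{R}^m)$ is the set of Borel probability measures $\mu$ on $\mathbb{R}^m$ with $\int|x|^2\,d\mu<\infty$, with the $2$-Wasserstein distance $W_2(\mu,\nu)=\inf_{\gamma}\left(\int_{\mathbb{R}^{2m}}|x-y|^2\,d\gamma(x,y)\right)^{1/2}$, the infimum being over all couplings $\gamma$ of $\mu$ and $\nu$; $|\cdot|$ is the Euclidean norm. Absolutely continuous means with respect to Lebesgue measure. $\mathbb{R}^m_+$ is the set of vectors $\theta=(\vartheta_1,\dots,\vartheta_m)$ with all $\vartheta_i>0$, and $D_\theta=\mathrm{diag}(1/\vartheta_1,\dots,1/\vartheta_m)$. For $\mu_0$ with density $f$, $\mu_\theta$ is the measure with density $x\mapsto\det(D_\theta)f(D_\theta x)$, and $\mathcal{M}^{\mathrm{dil}}(\mu_0,\Theta)=\{\mu_\theta:\theta\in\Theta\}$.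 $P_i\mu$ is the $i$-th one-dimensional marginal of $\mu$, and $M_2(P_i\mu)=\int_{\mathbb{R}^m}|x_i|^2\,d\mu(x)$. Functional Wassmap algorithm (exponent $p$, embedding dimension $d$). Input: measures $\mu_1,\dots,\mu_N\in\mathbb{W}_p(\mathbb{R}^m)$. (1) Form the $N\times N$ matrix $W$ with $W_{ij}=W_p(\mu_i,\mu_j)^2$. (2) Set $B=-\tfrac12 HWH$ with $H=I-\tfrac1N\mathbb{1}_N$, where $\mathbb{1}_N$ is the $N\times N$ all-ones matrix. (3) Take the truncated eigendecomposition $B_d=V_d\Lambda_dV_d^T$, where $\Lambda_d$ is the diagonal matrix of the $d$ largest eigenvalues of $B$ and the columns of $V_d$ are corresponding orthonormal eigenvectors (if $d>N$, pad with zero columns). (4) Output $z_i=$ the $i$-th row of $V_d\Lambda_d^{1/2}$, $i=1,\dots,N$, as points in $\mathbb{R}^d$. The algorithm recovers $\{y_i\}_{i=1}^N\subset\mathbb{R}^d$ up to rigid transformation if the eigenvalues in $\Lambda_d$ are nonnegative and, for any choice of eigenvectors, there is a Euclidean isometry $R(x)=Qx+b$ of $\mathbb{R}^d$ ($Q$ orthogonal) with $z_i=R(y_i)$ for all $i$. *)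

(* Defs.v *)
From HB Require Import structures.
From mathcomp Require Import all_boot all_order all_algebra.
From mathcomp Require Import all_classical all_reals all_analysis.

Set Implicit Arguments.
Unset Strict Implicit.
Unset Printing Implicit Defensive.
Import Order.TTheory GRing.Theory Num.Theory.
Import numFieldNormedType.Exports.

Local Open Scope classical_set_scope.
Local Open Scope ring_scope.

(* Measures live on tuples, whose product sigma-algebra is the Borel
   sigma-algebra of R^m; vectors of linear algebra are columns. *)
Notation euclidean R m := (m.-tuple (measurableTypeR R)).

Section Euclidean.
Context {R : realType}.

Definition to_cV m (x : euclidean R m) : 'cV[R]_m := \col_i tnth x i.

Definition of_cV m (v : 'cV[R]_m) : euclidean R m := [tuple v i 0 | i < m].

(* The library's norm on matrices is the sup norm. *)
Definition enorm m (v : 'cV[R]_m) : R := Num.sqrt (\sum_i v i 0 ^+ 2).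

Lemma to_cVK m : cancel (@to_cV m) (@of_cV m).
Proof. by move=> x; apply: eq_from_tnth => i; rewrite tnth_mktuple mxE. Qed.

Lemma of_cVK m : cancel (@of_cV m) (@to_cV m).
Proof. by move=> v; apply/colP => i; rewrite mxE tnth_mktuple. Qed.

End Euclidean.

Section LebesgueEuclidean.
Context {R : realType}.

Definition cons_pair m (p : measurableTypeR R * euclidean R m) :
  euclidean R m.+1 := [tuple of p.1 :: p.2].

Lemma measurable_cons_pair m : measurable_fun setT (@cons_pair m).
Proof. exact: measurable_cons. Qed.

Fixpoint lebesgue_euclidean m : set (euclidean R m) -> \bar R :=
  match m return set (euclidean R m) -> \bar R with
  | 0 => \d_([tuple] : euclidean R 0)
  | m'.+1 => pushforward (lebesgue_measure \x @lebesgue_euclidean m')%E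
               (@cons_pair m')
  end.
Arguments lebesgue_euclidean : clear implicits.

Section Step.
Variables (m : nat) (mu : {sigma_finite_measure set (euclidean R m) -> \bar R}).

Let step := pushforward (@lebesgue_measure R \x mu)%E (@cons_pair m).

Let step0 : step set0 = 0%E.
Proof. by have mf := @measurable_cons_pair m; exact: measure0. Qed.

Let step_ge0 A : (0 <= step A)%E.
Proof. by have mf := @measurable_cons_pair m; exact: measure_ge0. Qed.

Let step_sigma_additive : semi_sigma_additive step.
Proof.
by have mf := @measurable_cons_pair m; exact: measure_semi_sigma_additive.
Qed.

HB.instance Definition _ := isMeasure.Build _ _ _ step
  step0 step_ge0 step_sigma_additive.

Let step_sigma_finite : sigma_finite setT step.
Proof.
have /sigma_finiteP[F [TF ndF Foo]] := sigma_finiteT (@lebesgue_measure R).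
have /sigma_finiteP[G [TG ndG Goo]] := sigma_finiteT mu.
pose u (x : euclidean R m.+1) : measurableTypeR R * euclidean R m :=
  (thead x, [tuple of behead x]).
have consK : cancel (@cons_pair m) u.
  by move=> [a x]; congr pair; apply/val_inj.
have mu_ : measurable_fun setT u.
  by apply/measurable_fun_pairP; split;
    [exact: measurable_tnth|exact: measurable_behead].
exists (fun k => u @^-1` (F k `*` G k)) => [|k].
  rewrite -preimage_bigcup (_ : \bigcup_k _ = setT) ?preimage_setT//.
  apply/seteqP; split=> // -[a x] _.
  have [i _ Fi] : (\bigcup_i F i) a by rewrite -TF.
  have [j _ Gj] : (\bigcup_i G i) x by rewrite -TG.
  exists (maxn i j) => //; split=> /=.
    by move: a Fi; exact/subsetPset/ndF/leq_maxl.
  by move: x Gj; exact/subsetPset/ndG/leq_maxr.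
have [mF Fk] := Foo k; have [mG Gk] := Goo k; split.
  by rewrite -[X in measurable X]setTI; apply: mu_ => //; exact: measurableX.
rewrite /step /pushforward -comp_preimage (_ : u \o _ = id); last exact/funext.
by rewrite product_measure1E// lte_mul_pinfty// ge0_fin_numE.
Qed.

HB.instance Definition _ :=
  Measure_isSigmaFinite.Build _ _ _ step step_sigma_finite.

Lemma lebesgue_step : {nu : {sigma_finite_measure set _ -> \bar R} |
  (nu : set _ -> \bar R) = step}.
Proof. by exists step. Qed.

End Step.

Lemma lebesgue_euclideanP m :
  {mu : {sigma_finite_measure set (euclidean R m) -> \bar R} |
    (mu : set _ -> \bar R) = lebesgue_euclidean m}.
Proof.
elim: m => [|m [mu muE]]; first by exists (\d_([tuple] : euclidean R 0)).
by have [nu nuE] := lebesgue_step mu; exists nu; rewrite nuE muE.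
Qed.

Let leb0 m : lebesgue_euclidean m set0 = 0%E.
Proof. by have [mu <-] := lebesgue_euclideanP m; rewrite measure0. Qed.

Let leb_ge0 m A : (0 <= lebesgue_euclidean m A)%E.
Proof. by have [mu <-] := lebesgue_euclideanP m; exact: measure_ge0. Qed.

Let leb_additive m : semi_sigma_additive (lebesgue_euclidean m).
Proof.
by have [mu <-] := lebesgue_euclideanP m; exact: measure_semi_sigma_additive.
Qed.

HB.instance Definition _ m := isMeasure.Build _ _ _ (lebesgue_euclidean m)
  (@leb0 m) (@leb_ge0 m) (@leb_additive m).

Let leb_sigma_finite m : sigma_finite setT (lebesgue_euclidean m).
Proof. by have [mu <-] := lebesgue_euclideanP m; exact: sigma_finiteT. Qed.

HB.instance Definition _ m := Measure_isSigmaFinite.Build _ _ _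
  (lebesgue_euclidean m) (@leb_sigma_finite m).

Lemma lebesgue_euclidean_box m (A : 'I_m -> set (measurableTypeR R)) :
  (forall i, measurable (A i)) ->
  lebesgue_euclidean m [set x | forall i, A i (tnth x i)] =
  (\prod_(i < m) lebesgue_measure (A i))%E.
Proof.
elim: m A => [|m IH] A mA.
  by rewrite big_ord0 /= diracE mem_set// => -[].
rewrite big_ord_recl -IH//= /pushforward.
have mB : measurable [set x : euclidean R m | forall i, A (lift ord0 i) (tnth x i)].
  rewrite (_ : [set _ | _] =
      \bigcap_(i in [set: 'I_m]) ((@tnth m _)^~ i @^-1` A (lift ord0 i))).
    apply: fin_bigcap_measurable => // i _.
    by rewrite -[X in measurable X]setTI; exact: measurable_tnth.
  by apply/seteqP; split=> x /= H i; [move=> _|]; exact: H.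
rewrite -product_measure1E//; congr (product_measure1 _ _ _).
apply/seteqP; split=> [[a x] /= H|[a x] [/= Ha Hx] i].
  split=> [|i]; first exact: (H ord0).
  by have := H (lift ord0 i); rewrite tnthS.
by case: (unliftP ord0 i) => [j ->|->//]; rewrite tnthS.
Qed.

End LebesgueEuclidean.
Arguments lebesgue_euclidean {R} m.

Section Wasserstein.
Context {R : realType} {m : nat}.
Local Open Scope ereal_scope.
Implicit Types mu nu : probability (euclidean R m) R.

(* With [mu] Borel and of mass 1, this is mu \in W_2(R^m). *)
Definition finite_second_moment mu :=
  \int[mu]_x ((enorm (to_cV x) ^+ 2)%R)%:E < +oo.

Definition coupling mu nu
    (gamma : probability (euclidean R m * euclidean R m)%type R) :=
  forall A, measurable A ->
    pushforward gamma fst A = mu A /\ pushforward gamma snd A = nu A.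

Definition transport_cost
    (gamma : probability (euclidean R m * euclidean R m)%type R) : \bar R :=
  \int[gamma]_p ((enorm (to_cV p.1 - to_cV p.2) ^+ 2)%R)%:E.

Definition wasserstein2 mu nu : \bar R :=
  ereal_inf [set sqrte (transport_cost gamma) | gamma in coupling mu nu].

Definition marginal mu (i : 'I_m) : set (measurableTypeR R) -> \bar R :=
  pushforward mu (fun x => tnth x i).

End Wasserstein.

Definition second_moment {R : realType}
    (nu : set (measurableTypeR R) -> \bar R) : \bar R :=
  (\int[nu]_x (`|x| ^+ 2)%:E)%E.

Section Dilation.
Context {R : realType} {m : nat}.
Implicit Types (mu nu : probability (euclidean R m) R) (theta : 'cV[R]_m).

Definition has_density mu (f : euclidean R m -> R) :=
  [/\ measurable_fun setT f, forall x, 0 <= f x &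
      forall A, measurable A ->
        mu A = (\int[lebesgue_euclidean m]_(x in A) (f x)%:E)%E].

Definition dilation_mx theta : 'M[R]_m := diag_mx (\row_i (theta i 0)^-1).

Definition dilated_density theta (f : euclidean R m -> R) : euclidean R m -> R :=
  fun x => \det (dilation_mx theta) * f (of_cV (dilation_mx theta *m to_cV x)).

(* [nu] is mu_theta; densities being a.e. unique, the choice of [f] is
   irrelevant. *)
Definition is_dilation mu theta nu :=
  exists2 f, has_density mu f & has_density nu (dilated_density theta f).

End Dilation.

Section Wassmap.
Context {R : realType}.

Definition sqdist_mx N m (mu : 'I_N -> probability (euclidean R m) R) : 'M[R]_N :=
  \matrix_(i, j) fine (wasserstein2 (mu i) (mu j)) ^+ 2.

Definition centering_mx N : 'M[R]_N := 1%:M - N%:R^-1 *: const_mx 1.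

Definition wassmap_mx N m (mu : 'I_N -> probability (euclidean R m) R) : 'M[R]_N :=
  - 2^-1 *: (centering_mx N *m sqdist_mx mu *m centering_mx N).

(* [s] lists the eigenvalues with multiplicity; for a symmetric [B], such as
   [wassmap_mx mu], it exists and is unique. *)
Definition is_spectrum N (B : 'M[R]_N) (s : seq R) :=
  sorted >=%R s /\ char_poly B = \prod_(a <- s) ('X - a%:P).

(* [s`_j] is the j-th largest eigenvalue, and 0 beyond the N-th, so that both
   factors of the truncated eigendecomposition are zero-padded when d > N. *)
Definition top_eigenvectors N d (B : 'M[R]_N) (s : seq R) (V : 'M[R]_(N, d)) :=
  [/\ forall j : 'I_d, (j < N)%N -> B *m col j V = s`_j *: col j V,
      forall j k : 'I_d, (j < N)%N -> (k < N)%N ->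
        (col j V)^T *m col k V = (j == k)%:R%:M &
      forall j : 'I_d, (N <= j)%N -> col j V = 0].

Definition embedding N d (s : seq R) (V : 'M[R]_(N, d)) (i : 'I_N) : 'cV[R]_d :=
  (row i (V *m diag_mx (\row_j Num.sqrt s`_j)))^T.

Definition wassmap_recovers N m d (mu : 'I_N -> probability (euclidean R m) R)
    (y : 'I_N -> 'cV[R]_d) :=
  forall s, is_spectrum (wassmap_mx mu) s ->
    (forall j : 'I_d, 0 <= s`_j) /\
    forall V : 'M[R]_(N, d), top_eigenvectors (wassmap_mx mu) s V ->
      exists (Q : 'M[R]_d) (b : 'cV[R]_d),
        Q^T *m Q = 1%:M /\ forall i, embedding s V i = Q *m y i + b.

End Wassmap.

(* Main.v *)
From HB Require Import structures.
Require Import Defs.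
From mathcomp Require Import all_boot all_order all_algebra.
From mathcomp Require Import all_classical all_reals all_analysis.
From mathcomp Require Import measurable_realfun ring zify lra.

Import Order.TTheory GRing.Theory Num.Theory.
Import numFieldNormedType.Exports.
Local Open Scope classical_set_scope.
Local Open Scope ring_scope.

Set Implicit Arguments.
Unset Strict Implicit.
Unset Printing Implicit Defensive.

(* The measure mu_theta is the image of mu0 under the linear map
   x |-> (theta_i x_i)_i, so pushing mu0 forward by a pair of such maps couples
   mu_theta and mu_eta at cost sum_i (theta_i - eta_i)^2 M_2(P_i mu0).  No
   coupling does better: for a, b > 0 one has
   (x - y)^2 >= (1 - b/a) x^2 + (1 - a/b) y^2, and the integral of the right-hand
   side only depends on the marginals.  Hence the matrix W consists of the
   squared Euclidean distances between the points S theta_i, and B = X X^T where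
   the rows of X are the centered points.  As X X^T has at most m nonzero
   eigenvalues, V_m Lambda_m V_m^T is all of B, so the output has the same Gram
   matrix as the centered points; two families of vectors with the same Gram
   matrix differ by an orthogonal map, a product of Householder reflections. *)

(** * Reflections and families of vectors with the same Gram matrix *)

Section EuclideanLinearAlgebra.
Context {R : rcfType}.

Lemma mulmx_trmx_row d (u : 'rV[R]_d) :
  u *m u^T = (\sum_j u 0 j ^+ 2)%:M.
Proof.
by rewrite [LHS]mx11_scalar mxE; congr _%:M; apply: eq_bigr => j _;
  rewrite mxE expr2.
Qed.

Lemma sum_sqr_eq0 d (u : 'rV[R]_d) : (\sum_j u 0 j ^+ 2 == 0) = (u == 0).
Proof.
apply/idP/eqP => [|->]; last first.
  by rewrite big1// => j _; rewrite mxE expr0n.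
rewrite psumr_eq0 => [/allP u0|j _]; last exact: sqr_ge0.
apply/rowP => j; rewrite mxE; apply/eqP.
by rewrite -sqrf_eq0; apply: u0; rewrite mem_index_enum.
Qed.

(** This trace is the sum of the squares of all entries of [E]. *)
Lemma mxtrace_mulmx_trmx_eq0 n d (E : 'M[R]_(n, d)) :
  \tr (E *m E^T) = 0 -> E = 0.
Proof.
move=> E0; apply/row_matrixP => i; rewrite row0; apply/eqP.
rewrite -sum_sqr_eq0; move/eqP: E0; rewrite psumr_eq0 => [/allP/(_ i)|k _].
  rewrite mem_index_enum => /(_ isT)/eqP EEi; apply/eqP.
  by rewrite -[RHS]EEi mxE; apply: eq_bigr => j _; rewrite !mxE expr2.
by rewrite mxE sumr_ge0// => j _; rewrite mxE -expr2 sqr_ge0.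
Qed.

(* For [w = 0] the junk value [0^-1 = 0] makes this the identity. *)
Definition householder d (w : 'rV[R]_d) : 'M[R]_d :=
  1%:M - (2 / \sum_j w 0 j ^+ 2) *: (w^T *m w).

Lemma tr_householder d (w : 'rV[R]_d) : (householder w)^T = householder w.
Proof.
by rewrite /householder linearB/= linearZ/= trmx1 trmx_mul trmxK.
Qed.

Lemma mulmx_householder n d (A : 'M[R]_(n, d)) (w : 'rV[R]_d) :
  A *m householder w = A - (2 / \sum_j w 0 j ^+ 2) *: (A *m w^T *m w).
Proof. by rewrite mulmxBr mulmx1 -scalemxAr mulmxA. Qed.

Lemma householder_orthogonal d (w : 'rV[R]_d) :
  householder w *m householder w = 1%:M.
Proof.
rewrite mulmx_householder.
(* A reflection sends its normal [w] to [- w]; for [w = 0] both sides vanish. *)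
have -> : householder w *m w^T = - w^T.
  rewrite -[householder w]tr_householder -trmx_mul mulmx_householder.
  rewrite mulmx_trmx_row mul_scalar_mx scalerA.
  have [->|w0] := eqVneq w 0; first by rewrite scaler0 subr0 trmx0 oppr0.
  by rewrite mulfVK ?sum_sqr_eq0// scaler_nat mulr2n opprD addrA subrr sub0r linearN.
by rewrite /householder mulNmx scalerN opprK subrK.
Qed.

Lemma householder_fix n d (A : 'M[R]_(n, d)) (w : 'rV[R]_d) :
  A *m w^T = 0 -> A *m householder w = A.
Proof. by move=> Aw; rewrite mulmx_householder Aw mul0mx scaler0 subr0. Qed.

(** Vectors of equal norm are mirror images in the hyperplane orthogonal to their difference. *)
Lemma householder_swap d (x z : 'rV[R]_d) :
  z *m z^T = x *m x^T -> x *m householder (z - x) = z.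
Proof.
move=> zx; have [->|w0] := eqVneq z x.
  by rewrite householder_fix// subrr trmx0 mulmx0.
have xz : z *m x^T = x *m z^T.
  by apply/rowP => i; rewrite !ord1 !mxE; apply: eq_bigr => j _; rewrite !mxE mulrC.
(* As [z] and [x] have the same norm, the reflection subtracts exactly -1 times [z - x] from [x]. *)
have ww : (z - x) *m (z - x)^T = - 2 *: (x *m (z - x)^T).
  rewrite linearB/= mulmxBr !mulmxBl zx xz.
  by rewrite mulmxBr scaleNr scaler_nat mulr2n -[X in X - _]opprB -opprD.
set w := z - x in ww *.
have w2 : \sum_j w 0 j ^+ 2 != 0 by rewrite sum_sqr_eq0 subr_eq0.
rewrite mulmx_householder.
have -> : x *m w^T = (- (\sum_j w 0 j ^+ 2) / 2)%:M.
  rewrite mulmx_trmx_row in ww.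
  apply: (@scalerI _ _ (- 2)); first by rewrite oppr_eq0 pnatr_eq0.
  by rewrite -ww scale_scalar_mx; congr _%:M; field.
rewrite mul_scalar_mx scalerA [X in X *: _](_ : _ = -1); last by field.
by rewrite scaleN1r opprK addrC subrK.
Qed.

(** Induction on the rows. Once [Q] matches all rows but the first, [y = x *m Q^T] has the norm of
    [z] and the same inner products with the rows of [Z']. The reflection along [z - y] thus takes
    [y] to [z] and fixes those rows. *)
Lemma gram_orthogonal n d (X Z : 'M[R]_(n, d)) :
  Z *m Z^T = X *m X^T -> exists2 Q : 'M[R]_d, Q^T *m Q = 1%:M & Z = X *m Q^T.
Proof.
elim: n X Z => [|n IH] X Z; first by exists 1%:M; rewrite ?flatmx0// trmx1 mulmx1.
move: X Z; rewrite -[n.+1]/(1 + n)%N => X Z.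
rewrite -[X]vsubmxK -[Z]vsubmxK !tr_col_mx !mul_col_row.
move: (usubmx _) (dsubmx _) (usubmx _) (dsubmx _) => x X' z Z'.
move=> /eq_block_mx[zz _ Zz ZZ].
have [Q QQ ZE] := IH _ _ ZZ.
have [y yE] : {y | y = x *m Q^T} by exists (x *m Q^T).
exists (householder (z - y) *m Q).
  rewrite trmx_mul tr_householder -mulmxA (mulmxA (householder _)).
  by rewrite householder_orthogonal mul1mx.
rewrite trmx_mul tr_householder mulmxA mul_col_mx -yE -ZE mul_col_mx.
congr col_mx.
  rewrite householder_swap// zz yE trmx_mul trmxK mulmxA.
  by rewrite -(mulmxA x) QQ mulmx1.
rewrite householder_fix// linearB/= mulmxBr Zz yE trmx_mul trmxK.
by rewrite ZE mulmxA -(mulmxA X') QQ mulmx1 subrr.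
Qed.

End EuclideanLinearAlgebra.

(** * Characteristic polynomials of A B and B A *)

Section CharPolyMul.

(** Two triangular multipliers, one on each side, clear the block [B] of [M] without dividing by
    [t]; this allows [t] to be the indeterminate below. *)
Lemma det_scalar_sub_mul (K : comNzRingType) n m (t : K)
    (A : 'M[K]_(n, m)) (B : 'M[K]_(m, n)) :
  t ^+ m * \det (t%:M - A *m B) = t ^+ n * \det (t%:M - B *m A).
Proof.
pose M := block_mx t%:M A B 1%:M.
have -> : \det (t%:M - A *m B) = \det M.
  have := det_mulmx M (block_mx 1%:M 0 (- B) 1%:M).
  rewrite det_lblock !det1 !mulr1 mulmx_block.
  rewrite !mulmx1 !mulmxN !mulmx0 !add0r mul1mx subrr.
  by rewrite det_ublock det1 mulr1.
have := det_mulmx (block_mx 1%:M 0 (- B) t%:M) M.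
rewrite det_lblock det1 mul1r det_scalar mulmx_block.
rewrite !mul1mx !mul0mx !addr0 !mulNmx mul_scalar_mx mulmx1 mul_mx_scalar addNr.
by rewrite det_ublock det_scalar addrC => <-.
Qed.

Lemma char_poly_mulC (K : comNzRingType) n m (A : 'M[K]_(n, m)) (B : 'M[K]_(m, n)) :
  'X^m * char_poly (A *m B) = 'X^n * char_poly (B *m A).
Proof.
by rewrite /char_poly /char_poly_mx !map_mxM; exact: det_scalar_sub_mul.
Qed.

End CharPolyMul.

(** * Spectra of Gram matrices and the truncated eigendecomposition *)

Section Spectrum.
Context {R : realType}.

Lemma size_spectrum N (B : 'M[R]_N) s : is_spectrum B s -> size s = N.
Proof.
by case=> _ /(congr1 (fun p : {poly R} => size p));
  rewrite size_char_poly size_prod_XsubC => -[].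
Qed.

Lemma sum_spectrum N (B : 'M[R]_N) s : is_spectrum B s -> \sum_(a <- s) a = \tr B.
Proof.
move=> Bs; have sN := size_spectrum Bs; case: Bs => _.
case: N => [|N] in B sN *.
  by move=> _; rewrite (size0nil sN) big_nil /mxtrace big_ord0.
move=> chi; apply: oppr_inj; rewrite -coefPn_prod_XsubC ?sN//= -chi.
exact: char_poly_trace.
Qed.

(** For an eigenvector [v], the squared norm of [v *m X] is [a] times that of [v]. *)
Lemma spectrum_gram_ge0 N d (X : 'M[R]_(N, d)) s a :
  is_spectrum (X *m X^T) s -> a \in s -> 0 <= a.
Proof.
case=> _ chi; rewrite -root_prod_XsubC -chi -eigenvalue_root_char.
case/eigenvalueP => v vX; rewrite -sum_sqr_eq0 => v0.
have : (v *m X) *m (v *m X)^T = a *: (v *m v^T).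
  by rewrite trmx_mul !mulmxA -(mulmxA v) vX -scalemxAl.
rewrite !mulmx_trmx_row scale_scalar_mx => /matrixP/(_ 0 0).
rewrite !mxE !mulr1n => vXE.
have v_gt0 : 0 < \sum_j v 0 j ^+ 2.
  by rewrite lt_neqAle eq_sym v0 sumr_ge0// => j _; exact: sqr_ge0.
by rewrite -(pmulr_lge0 _ v_gt0) -vXE sumr_ge0// => j _; exact: sqr_ge0.
Qed.

Lemma spectrum_gram_nth_ge0 N d (X : 'M[R]_(N, d)) s j :
  is_spectrum (X *m X^T) s -> 0 <= s`_j.
Proof.
move=> Bs; have [js|js] := ltnP j (size s); last by rewrite nth_default.
by apply: spectrum_gram_ge0 Bs _; exact: mem_nth.
Qed.

(* [X X^T] and [X^T X] have the same nonzero eigenvalues, so ['X^N] divides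
   ['X^d] times the characteristic polynomial of [X X^T]: at most [d] of the
   eigenvalues are nonzero. *)
Lemma spectrum_gram_tail N d (X : 'M[R]_(N, d)) s j :
  is_spectrum (X *m X^T) s -> (d <= j)%N -> s`_j = 0.
Proof.
move=> Bs dj; have sN := size_spectrum Bs.
have [js|js] := ltnP j (size s); last by rewrite nth_default.
apply/eqP; apply/negPn/negP => sj0.
have sj_gt0 : 0 < s`_j.
  by rewrite lt_neqAle eq_sym sj0 (spectrum_gram_nth_ge0 _ Bs).
have [ss chi] := Bs.
have := char_poly_mulC X X^T; rewrite chi -(cat_take_drop j.+1 s) big_cat/=.
set p1 := \prod_(a <- take _ _) _; set p2 := \prod_(a <- drop _ _) _ => E.
have cop : coprimep 'X^N p1.
  apply: coprimep_expl; rewrite coprimep_sym -[X in coprimep _ X]subr0 -polyC0.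
  rewrite coprimep_XsubC root_prod_XsubC; apply/negP => /(nthP 0)[i].
  rewrite size_takel// => ij; rewrite nth_take// => si0.
  have : s`_j <= s`_i.
    have ge_trans : transitive (>=%R : rel R) by move=> y x z xy /le_trans; exact.
    have := sorted_leq_nth ge_trans (@lexx _ _) 0 ss; apply => //.
    by rewrite inE (leq_trans ij).
  by rewrite si0 leNgt sj_gt0.
(* By coprimality ['X^N] divides ['X^d * p2], of degree [d + (N - j.+1)], which is less than [N] as
   [d <= j]. *)
have : 'X^N %| p1 * ('X^d * p2) by rewrite mulrCA E dvdp_mulr.
rewrite Gauss_dvdpr// => /dvdp_leq.
rewrite mulf_neq0 ?monic_neq0 ?monicXn//; last first.
  exact: monic_prod_XsubC.
move=> /(_ isT); rewrite size_polyXn.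
rewrite size_Mmonic ?monic_neq0 ?monicXn//; last first.
  exact: monic_prod_XsubC.
by rewrite size_polyXn size_prod_XsubC size_drop -sN; lia.
Qed.

Lemma sum_ord_tail0 (F : nat -> R) a b :
  (forall i, (minn a b <= i)%N -> F i = 0) -> \sum_(i < a) F i = \sum_(i < b) F i.
Proof.
wlog ab : a b / (a <= b)%N => [W F0|].
  have [|/ltnW] := leqP a b => ab; first exact: W.
  by apply/esym/W => // i; rewrite minnC; exact: F0.
rewrite (minn_idPl ab) => F0.
rewrite -!(big_mkord xpredT F) (big_cat_nat (leq0n a) ab)/=.
rewrite [X in _ = _ + X]big_nat_cond [X in _ = _ + X]big1 ?addr0//.
move=> i /andP[/andP[ai _] _].
exact: F0.
Qed.

(** Completeness of the kept eigenvectors comes from a trace count: the discarded part is [E *m E^T]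
    for a suitable [E], and its trace is the sum of all eigenvalues minus the sum of the first [d],
    that is 0. *)
Lemma truncated_eigendecomposition N d (X : 'M[R]_(N, d)) s (V : 'M[R]_(N, d)) :
  is_spectrum (X *m X^T) s -> top_eigenvectors (X *m X^T) s V ->
  V *m diag_mx (\row_j s`_j) *m V^T = X *m X^T.
Proof.
move=> Bs [BV VV V0]; set B := X *m X^T in Bs BV *; set D := diag_mx _.
have sN := size_spectrum Bs.
have s0 j : (minn N d <= j)%N -> s`_j = 0.
  rewrite geq_min => /orP[Nj|]; last exact: spectrum_gram_tail Bs.
  by rewrite nth_default// sN.
have BVD : B *m V = V *m D.
  apply/matrixP => i j; rewrite mul_mx_diag [RHS]mxE [X in _ * X]mxE mulrC.
  transitivity ((B *m col j V) i 0).
    by rewrite [LHS]mxE [RHS]mxE; apply: eq_bigr => k _; rewrite [col _ _ _ _]mxE.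
  have [jN|Nj] := ltnP j N; first by rewrite BV// !mxE.
  rewrite V0// mulmx0 mxE; have /colP/(_ i) := V0 j Nj.
  by rewrite [LHS]mxE [RHS]mxE => ->; rewrite mulr0.
(* If [d > N], zero columns keep [V^T *m V] from being the identity, but [D] vanishes at those
   indices. *)
have VVD : V^T *m V *m D = D.
  apply/matrixP => j k; rewrite mul_mx_diag.
  have -> : D j k = (j == k)%:R * s`_k.
    by rewrite !mxE mulr_natl; have [->|] := eqVneq j k; rewrite ?mulr1n ?mulr0n.
  rewrite mxE [X in _ * X]mxE.
  have [kd|kd] := leqP (minn N d) k; first by rewrite s0// !mulr0.
  have kN : (k < N)%N by apply: leq_trans kd _; exact: geq_minl.
  congr (_ * _); have [jN|Nj] := ltnP j N; last first.
    have /colP V0j := V0 j Nj.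
    rewrite mxE big1 => [|i _]; last by have := V0j i; rewrite !mxE => ->; rewrite mul0r.
    by have [jk|//] := eqVneq j k; move: Nj; rewrite jk leqNgt kN.
  have := VV j k jN kN; move=> /matrixP/(_ 0 0); rewrite !mxE mulr1n => <-.
  by apply: eq_bigr => i _; rewrite !mxE.
have DT : D^T = D by rewrite tr_diag_mx.
have BT : B^T = B by rewrite trmx_mul trmxK.
have VB : V^T *m B = D *m V^T by rewrite -BT -trmx_mul BVD trmx_mul DT.
(* The part of the columns of [X] orthogonal to the eigenvectors in [V]. *)
pose E := X - V *m V^T *m X.
have EX : E *m X^T = B - V *m D *m V^T.
  by rewrite mulmxBl -!(mulmxA V) -VB !mulmxA -(mulmxA _ X).
have VDV : V *m D *m V^T *m V = V *m D.
  rewrite -!mulmxA; congr (_ *m _).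
  by rewrite -[LHS]trmxK trmx_mul DT [(V^T *m V)^T]trmx_mul trmxK VVD DT.
have EE : E *m E^T = B - V *m D *m V^T.
  rewrite {2}/E linearB/= !trmx_mul trmxK mulmxBr !mulmxA EX.
  by rewrite (mulmxBl B) BVD VDV subrr mul0mx subr0.
apply/eqP; rewrite eq_sym -subr_eq0 -EE; apply/eqP.
rewrite (@mxtrace_mulmx_trmx_eq0 _ _ _ E) ?mul0mx// EE linearB/= -(sum_spectrum Bs).
rewrite mxtrace_mulC mulmxA VVD mxtrace_diag (big_nth 0) big_mkord sN.
rewrite (@sum_ord_tail0 (fun i => s`_i) _ _ s0).
rewrite [X in _ - X](eq_bigr (fun i : 'I_d => s`_i)) ?subrr// => i _.
by rewrite mxE.
Qed.

Lemma embedding_recovers N d (X V : 'M[R]_(N, d)) s :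
  is_spectrum (X *m X^T) s -> top_eigenvectors (X *m X^T) s V ->
  exists2 Q : 'M[R]_d, Q^T *m Q = 1%:M &
    forall i, embedding s V i = Q *m (row i X)^T.
Proof.
move=> Bs topV; set Z := V *m diag_mx (\row_j Num.sqrt s`_j).
(* The eigenvalues are nonnegative, so squaring their roots turns [Z *m Z^T] into the truncated
   eigendecomposition. *)
have [|Q QQ ZE] := @gram_orthogonal _ _ _ X Z.
  rewrite -(truncated_eigendecomposition Bs topV) trmx_mul tr_diag_mx mulmxA.
  rewrite -[Z *m _]mulmxA mulmx_diag; congr (_ *m diag_mx _ *m _).
  by apply/rowP => j; rewrite !mxE -expr2 sqr_sqrtr// (spectrum_gram_nth_ge0 _ Bs).
by exists Q => // i; rewrite /embedding -/Z ZE row_mul trmx_mul trmxK.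
Qed.

(** * Double centering of squared distance matrices *)

Lemma centering_mxE N p (A : 'M[R]_(N, p)) i j :
  (centering_mx N *m A) i j = A i j - N%:R^-1 * \sum_k A k j.
Proof.
rewrite mulmxBl mul1mx -scalemxAl !mxE; congr (_ - _ * _).
by apply: eq_bigr => k _; rewrite mxE mul1r.
Qed.

Lemma centering_mx_const N p (v : 'rV[R]_p) :
  centering_mx N *m (\matrix_(i, j) v 0 j) = 0 :> 'M[R]_(N, p).
Proof.
apply/matrixP => i j; rewrite centering_mxE !mxE.
rewrite (eq_bigr (fun=> v 0 j)) => [|k _]; last by rewrite mxE.
rewrite sumr_const card_ord -[v 0 j *+ N]mulr_natl mulrA mulVf ?mul1r ?subrr//.
(* The row index [i] witnesses [0 < N]. *)
by rewrite pnatr_eq0 -lt0n (leq_ltn_trans _ (ltn_ord i)).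
Qed.

Lemma tr_centering_mx N : (centering_mx N : 'M[R]_N)^T = centering_mx N.
Proof.
rewrite linearB linearZ/= trmx1; congr (_ - _ *: _).
by apply/matrixP => i j; rewrite !mxE.
Qed.

(* The terms [|y_i|^2] and [|y_j|^2] of the squared distances are constant along
   rows or columns, so centering kills them. *)
Lemma centered_sqdist N d (y : 'I_N -> 'cV[R]_d) :
  let X := centering_mx N *m (\matrix_(i, k) y i k 0) in
  - 2^-1 *: (centering_mx N *m (\matrix_(i, j) \sum_k (y i k 0 - y j k 0) ^+ 2)
             *m centering_mx N) = X *m X^T.
Proof.
set H := centering_mx N; set Y := \matrix_(i, k) y i k 0; rewrite /=.
pose n2 : 'rV[R]_N := \row_j \sum_k y j k 0 ^+ 2.
pose A : 'M[R]_N := \matrix_(i, j) n2 0 j.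
have -> : \matrix_(i, j) \sum_k (y i k 0 - y j k 0) ^+ 2 = A + A^T - 2 *: (Y *m Y^T).
  apply/matrixP => i j; rewrite !mxE mulr_sumr -big_split/= -sumrB.
  by apply: eq_bigr => k _; rewrite !mxE; ring.
have HA : H *m A = 0 by exact: centering_mx_const.
have HT : H^T = H by exact: tr_centering_mx.
clearbody H; have AH : A^T *m H = 0 by rewrite -HT -trmx_mul HA trmx0.
rewrite mulmxBr mulmxDr HA add0r mulmxBl -(mulmxA H A^T) AH mulmx0 sub0r.
rewrite scaleNr scalerN opprK -scalemxAr -scalemxAl scalerA mulVf ?pnatr_eq0//.
by rewrite scale1r trmx_mul HT !mulmxA.
Qed.

Lemma wassmap_recovers_sqdist N m d (mu : 'I_N -> probability (euclidean R m) R)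
    (y : 'I_N -> 'cV[R]_d) :
  sqdist_mx mu = \matrix_(i, j) \sum_k (y i k 0 - y j k 0) ^+ 2 ->
  wassmap_recovers mu y.
Proof.
move=> muy s; rewrite /wassmap_mx muy centered_sqdist.
set X := _ *m _ => Bs.
split=> [j|V topV]; first exact: spectrum_gram_nth_ge0 Bs.
have [Q QQ VQ] := embedding_recovers Bs topV.
(* The rows of [X] are the [y i] minus their mean; the translation accounts for the mean. *)
exists Q, (- (Q *m (N%:R^-1 *: \sum_k y k))); split=> // i.
rewrite VQ -mulmxBr; congr (_ *m _); apply/colP => k.
rewrite 2!mxE centering_mxE !mxE summxE; congr (_ - _ * _).
by apply: eq_bigr => l _; rewrite mxE.
Qed.

End Spectrum.

(* The canonical measure structure on a pushforward takes a proof of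
   measurability that unification cannot supply. *)
Lemma pushforward_measure d d' (X : measurableType d) (Y : measurableType d')
    (R : realType) (mu : {measure set X -> \bar R}) (f : X -> Y) :
  measurable_fun setT f ->
  {nu : {measure set Y -> \bar R} | (nu : set Y -> \bar R) = pushforward mu f}.
Proof.
move=> mf.
by exists (measure_function_pushforward__canonical__measure_function_Measure mu mf).
Qed.

(** * Lebesgue measure under diagonal scaling *)

Section LebesgueScaling.
Context {R : realType}.

(** The right-hand side is a measure in [A] that gives half-open intervals their length. *)
Lemma lebesgue_measure_scale (c : R) (A : set (measurableTypeR R)) :
  0 < c -> measurable A ->
  lebesgue_measure A = (c%:E * lebesgue_measure ( *%R c @^-1` A))%E.
Proof.
move=> c0 mA; pose f : measurableTypeR R -> measurableTypeR R := *%R c.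
have mf : measurable_fun setT f by exact: mulrl_measurable.
have [nu nuE] := pushforward_measure (mscale (NngNum (ltW c0)) lebesgue_measure) mf.
transitivity (nu A); last by rewrite nuE.
apply: lebesgue_measure_unique => // X [[a b] _ <-]; rewrite nuE.
rewrite /pushforward/= /mscale/=.
have -> : f @^-1` `]a, b] = `]a / c, b / c]%classic.
  by apply/seteqP; split=> x /=; rewrite /f !in_itv/= ltr_pdivrMr// ler_pdivlMr// mulrC.
rewrite !lebesgue_measure_itv/= !lte_fin ltr_pM2r ?invr_gt0//.
case: ifPn => _; last by rewrite mule0.
by rewrite -!EFinB -EFinM; congr EFin; field; rewrite gt_eqF.
Qed.

Definition box m (A : 'I_m -> set (measurableTypeR R)) : set (euclidean R m) :=
  [set x | forall i, A i (tnth x i)].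

Lemma measurable_box m (A : 'I_m -> set (measurableTypeR R)) :
  (forall i, measurable (A i)) -> measurable (box A).
Proof.
move=> mA; rewrite (_ : box A =
    \bigcap_(i in [set: 'I_m]) ((@tnth m _)^~ i @^-1` A i)).
  apply: fin_bigcap_measurable => // i _.
  by rewrite -[X in measurable X]setTI; exact: measurable_tnth.
by apply/seteqP; split=> x /= H i; [move=> _|]; exact: H.
Qed.

Definition boxes m : set (set (euclidean R m)) :=
  [set box A | A in [set A : 'I_m -> _ | forall i, measurable (A i)]].

(** The generating sets constrain one coordinate only: they are boxes whose other sides are full. *)
Lemma measurable_boxes m (B : set (euclidean R m)) : measurable B -> <<s @boxes m >> B.
Proof.
apply: smallest_sub; first exact: smallest_sigma_algebra.
move=> C; rewrite -bigcup_seq => -[i _ [A mA <-]].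
apply: sub_sigma_algebra; exists (fun j => if j == i then A else setT).
  by move=> j; case: ifP.
rewrite setTI; apply/seteqP; split=> x /=.
  by move=> /(_ i); rewrite eqxx.
by move=> Ax j; case: eqP => // ->.
Qed.

(** Boxes are stable under intersection, and the cubes of finite measure exhaust the space. *)
Lemma boxes_unique m (m1 m2 : {measure set (euclidean R m) -> \bar R}) :
  (forall A, (forall i, measurable (A i)) -> m1 (box A) = m2 (box A)) ->
  (forall k : nat, (m1 (box (fun=> `](- k%:R)%R, k%:R%R : R]%classic)) < +oo)%E) ->
  forall B, measurable B -> m1 B = m2 B.
Proof.
move=> m12 m1oo B /measurable_boxes.
apply: (g_sigma_algebra_measure_unique (@boxes m) _
    (fun k : nat => box (fun=> `](- k%:R), k%:R])%classic)) => //.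
- by move=> _ [A mA <-]; exact: measurable_box.
- by move=> k; exists (fun=> `](- k%:R), k%:R]%classic).
(* The sum [r] bounds every coordinate of [x], so one cube serves them all. *)
- apply/seteqP; split=> // x _; pose r := \sum_i `|tnth x i|.
  exists (Num.truncn r).+1 => // i /=; rewrite in_itv/=.
  have : `|tnth x i| < (Num.truncn r).+1%:R.
    rewrite (le_lt_trans _ (truncnS_gt r))// /r (bigD1 i)//= lerDl.
    by rewrite sumr_ge0.
  by rewrite ltr_norml => /andP[-> /ltW ->].
- move=> _ _ [A mA <-] [A' mA' <-]; exists (fun i => A i `&` A' i).
    by move=> i; exact: measurableI.
  apply/seteqP; split=> x /=; first by move=> H; split=> i; case: (H i).
  by move=> [H H'] i; split.
- by move=> _ [A mA <-]; exact: m12.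
Qed.

(** For positive [theta], the inverse of the map given by [dilation_mx theta]. *)
Definition dilate m (theta : 'cV[R]_m) (x : euclidean R m) : euclidean R m :=
  [tuple theta i 0 * tnth x i | i < m].

Lemma measurable_dilate m (theta : 'cV[R]_m) : measurable_fun setT (dilate theta).
Proof.
apply/measurable_fun_tnthP => i; rewrite (_ : _ \o _ = fun x => theta i 0 * tnth x i).
  by apply: measurableT_comp; [exact: mulrl_measurable|exact: measurable_tnth].
by apply/funext => x /=; rewrite tnth_mktuple.
Qed.

(** On boxes both sides factor into one-dimensional scalings; uniqueness on boxes does the rest. *)
Lemma lebesgue_euclidean_dilate m (theta : 'cV[R]_m) (B : set (euclidean R m)) :
  (forall i, 0 < theta i 0) -> measurable B ->
  lebesgue_euclidean m B =
  ((\prod_i theta i 0)%:E * lebesgue_euclidean m (dilate theta @^-1` B))%E.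
Proof.
move=> theta0 mB; have mT := measurable_dilate theta.
have det_ge0 : 0 <= \prod_i theta i 0 by apply: prodr_ge0 => i _; exact: ltW.
have [nu nuE] :=
  pushforward_measure (mscale (NngNum det_ge0) (lebesgue_euclidean m)) mT.
transitivity (nu B); last by rewrite nuE.
move: B mB; apply: boxes_unique => // [A mA|k].
  rewrite nuE /pushforward/= /mscale/= lebesgue_euclidean_box//.
  have -> : dilate theta @^-1` box A = box (fun i => *%R (theta i 0) @^-1` A i).
    by apply/seteqP; split=> x /= H i; have := H i; rewrite tnth_mktuple.
  rewrite lebesgue_euclidean_box; last first.
    move=> i; rewrite -[X in measurable X]setTI.
    have mM := @mulrl_measurable R setT (theta i 0).
    by apply: mM => //; exact: mA.
  rewrite -prodEFin -big_split/=; apply: eq_bigr => i _.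
  exact: lebesgue_measure_scale.
rewrite /= lebesgue_euclidean_box// (eq_bigr (fun=> (k%:R + k%:R)%:E)); last first.
  move=> i _; rewrite lebesgue_measure_itv/= lte_fin.
  case: ifPn => [_|]; first by rewrite -EFinB opprK.
  (* Only [k = 0] is left: the interval is empty and its length [k + k] is 0. *)
  rewrite -leNgt => k0; congr EFin; apply/esym/eqP; rewrite paddr_eq0 ?ler0n// andbb.
  by move: k0; case: k => // k; rewrite leNgt gtrN ?ltr0n.
by rewrite prodEFin ltry.
Qed.

End LebesgueScaling.

(** * Dilated measures as pushforwards, and their second moments *)

Section Wasserstein.
Context {R : realType} {m : nat}.
Implicit Types (mu nu : probability (euclidean R m) R) (theta eta : 'cV[R]_m).

(** Change of variables: the Jacobian of [dilate theta] cancels the determinant in the dilated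
    density. *)
Lemma is_dilation_pushforward mu theta nu A :
  (forall i, 0 < theta i 0) -> is_dilation mu theta nu -> measurable A ->
  nu A = mu (dilate theta @^-1` A).
Proof.
move=> theta0 [f [mf f0 muE] [mg g0 nuE]] mA.
have mT := measurable_dilate theta.
have mTA : measurable (dilate theta @^-1` A).
  by rewrite -[X in measurable X]setTI; exact: mT.
set g := dilated_density theta f in mg g0 nuE.
have prod0 : \prod_i theta i 0 != 0 by apply/prodf_neq0 => i _; rewrite gt_eqF.
have det0 : 0 <= \prod_i theta i 0 by apply: prodr_ge0 => i _; exact: ltW.
have detE : \det (dilation_mx theta) = (\prod_i theta i 0)^-1.
  by rewrite det_diag -prodfV; apply: eq_bigr => i _; rewrite mxE.
have gT x : g (dilate theta x) = (\prod_i theta i 0)^-1 * f x.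
  rewrite /g /dilated_density detE; congr (_ * f _).
  apply: eq_from_tnth => i; rewrite tnth_mktuple mul_diag_mx !mxE tnth_mktuple.
  by rewrite mulKf// gt_eqF.
(* [L] is Lebesgue measure, written so that integrals pull back along [dilate theta]. *)
have [L LE] := pushforward_measure (mscale (NngNum det0) (lebesgue_euclidean m)) mT.
rewrite nuE// muE// (eq_measure_integral L) => [|B mB _]; last first.
  by rewrite LE; exact: lebesgue_euclidean_dilate.
have mgE : measurable_fun A (fun x => (g x)%:E).
  by apply/measurable_EFinP; exact: measurable_funTS.
rewrite LE ge0_integral_pushforward//; last first.
  by move=> x _; rewrite lee_fin.
have mfE : measurable_fun (dilate theta @^-1` A) (fun x => (f x)%:E).
  by apply/measurable_EFinP; exact: measurable_funTS.
under eq_integral do rewrite /= gT EFinM.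
rewrite ge0_integral_mscale//=; last 2 first.
- exact: measurable_funeM.
- by move=> x _; rewrite mule_ge0 ?lee_fin ?invr_ge0.
rewrite ge0_integralZl_EFin ?invr_ge0//; last by move=> x _; rewrite lee_fin.
by rewrite muleA -EFinM mulfV// mul1e.
Qed.

Lemma sqr_enorm (v : 'cV[R]_m) : enorm v ^+ 2 = \sum_i v i 0 ^+ 2.
Proof. by rewrite sqr_sqrtr// sumr_ge0// => i _; exact: sqr_ge0. Qed.

Lemma measurable_sqr_tnth (i : 'I_m) :
  measurable_fun setT (fun x : euclidean R m => (tnth x i ^+ 2)%:E).
Proof.
by apply/measurable_EFinP; apply: measurable_funX; exact: measurable_tnth.
Qed.

Lemma second_moment_marginal mu i :
  second_moment (marginal mu i) = (\int[mu]_x (tnth x i ^+ 2)%:E)%E.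
Proof.
rewrite /second_moment /marginal ge0_integral_pushforward//=.
- by apply: eq_integral => x _ /=; rewrite real_normK// num_real.
- exact: measurable_tnth.
- by apply/measurable_EFinP; apply: measurable_funX; exact: normr_measurable.
Qed.

Lemma second_moment_fin_num mu i : finite_second_moment mu ->
  (second_moment (marginal mu i) \is a fin_num)%E.
Proof.
move=> mu2; rewrite second_moment_marginal ge0_fin_numE; last first.
  by apply: integral_ge0 => x _; rewrite lee_fin sqr_ge0.
apply: le_lt_trans mu2; apply: ge0_le_integral => //.
- by move=> x _; rewrite lee_fin sqr_ge0.
- exact: measurable_sqr_tnth.
- under eq_fun do rewrite sqr_enorm.
  apply/measurable_EFinP; apply: measurable_sum => k.
  under eq_fun do rewrite mxE.
  by apply: measurable_funX; exact: measurable_tnth.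
- move=> x _; rewrite lee_fin sqr_enorm (bigD1 i)//= mxE lerDl.
  by rewrite sumr_ge0// => k _; exact: sqr_ge0.
Qed.

Lemma second_moment_dilation mu theta nu i :
  (forall i, 0 < theta i 0) -> is_dilation mu theta nu ->
  second_moment (marginal nu i) =
  ((theta i 0 ^+ 2)%:E * second_moment (marginal mu i))%E.
Proof.
move=> theta0 dil; rewrite !second_moment_marginal.
have [L LE] := pushforward_measure mu (measurable_dilate theta).
rewrite (eq_measure_integral L) => [|A mA _]; last first.
  by rewrite LE; exact: is_dilation_pushforward.
rewrite LE ge0_integral_pushforward//=.
- rewrite preimage_setT; under eq_integral do rewrite tnth_mktuple exprMn EFinM.
  rewrite ge0_integralZl_EFin ?sqr_ge0//; last exact: measurable_sqr_tnth.
  by move=> x _; rewrite lee_fin sqr_ge0.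
- exact: measurable_dilate.
- exact: measurable_sqr_tnth.
- by move=> x _; rewrite lee_fin sqr_ge0.
Qed.

(** * Transport costs and the distance between two dilations *)

Lemma measurable_sqr_diff_tnth (i : 'I_m) :
  measurable_fun setT (fun p : euclidean R m * euclidean R m =>
    ((tnth p.1 i - tnth p.2 i) ^+ 2)%:E).
Proof.
apply/measurable_EFinP; apply: measurable_funX; apply: measurable_funB.
  by apply: (measurableT_comp (measurable_tnth i)).
by apply: (measurableT_comp (measurable_tnth i)).
Qed.

Lemma transport_costE (gamma : probability (euclidean R m * euclidean R m)%type R) :
  transport_cost gamma =
  (\sum_i \int[gamma]_p ((tnth p.1 i - tnth p.2 i) ^+ 2)%:E)%E.
Proof.
rewrite /transport_cost -ge0_integral_sum//.
- apply: eq_integral => p _; rewrite sqr_enorm -sumEFin.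
  by apply: eq_bigr => i _; rewrite !mxE.
- exact: measurable_sqr_diff_tnth.
- by move=> i p _; rewrite lee_fin sqr_ge0.
Qed.

(** Each integrand depends on one component of the pair, hence on one marginal of [gamma]; this
    makes the lower bound on the cost the same for all couplings. *)
Lemma coupling_second_moments mu nu gamma i : coupling mu nu gamma ->
  (\int[gamma]_p (tnth p.1 i ^+ 2)%:E = second_moment (marginal mu i) /\
   \int[gamma]_p (tnth p.2 i ^+ 2)%:E = second_moment (marginal nu i))%E.
Proof.
have sqr_i0 : {in [set: euclidean R m], forall x, 0 <= (tnth x i ^+ 2)%:E}%E.
  by move=> x _; rewrite lee_fin sqr_ge0.
move=> gammaP; rewrite !second_moment_marginal; split.
- have [L LE] := pushforward_measure gamma
    (@measurable_fst _ _ (euclidean R m) (euclidean R m)).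
  rewrite [RHS](eq_measure_integral L) => [|A mA _]; last first.
    by rewrite LE; have [] := gammaP A mA.
  by rewrite LE ge0_integral_pushforward//; exact: measurable_sqr_tnth.
- have [L LE] := pushforward_measure gamma
    (@measurable_snd _ _ (euclidean R m) (euclidean R m)).
  rewrite [RHS](eq_measure_integral L) => [|A mA _]; last first.
    by rewrite LE; have [] := gammaP A mA.
  by rewrite LE ge0_integral_pushforward//; exact: measurable_sqr_tnth.
Qed.

(* Integrating [2 x y <= (b / a) x ^+ 2 + (a / b) y ^+ 2]: the dilations [a] and
   [b] make equality hold on the support of the optimal coupling
   [(a t, b t)]. *)
Lemma dilation_coordinate_cost mu theta eta nu nu' gamma i :
  (forall i, 0 < theta i 0) -> (forall i, 0 < eta i 0) ->
  finite_second_moment mu ->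
  is_dilation mu theta nu -> is_dilation mu eta nu' -> coupling nu nu' gamma ->
  (((theta i 0 - eta i 0) ^+ 2)%:E * second_moment (marginal mu i) <=
   \int[gamma]_p ((tnth p.1 i - tnth p.2 i) ^+ 2)%:E)%E.
Proof.
move=> theta0 eta0 mu2 dil dil' gammaP.
have := theta0 i; have := eta0 i; move: (theta i 0) (eta i 0)
  (second_moment_dilation i theta0 dil) (second_moment_dilation i eta0 dil').
move=> a b; have := second_moment_fin_num i mu2.
have [<- <-] := coupling_second_moments i gammaP.
set M := second_moment _ => /fineK <-; move: (fine M) => {}M.
set X := integral _ _ _; set Y := integral _ _ _; set C := integral _ _ _.
move=> XE YE b0 a0.
have mX : measurable_fun setT
    (fun p : euclidean R m * euclidean R m => (tnth p.1 i ^+ 2)%:E).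
  exact: (measurableT_comp (measurable_sqr_tnth i)).
have mY : measurable_fun setT
    (fun p : euclidean R m * euclidean R m => (tnth p.2 i ^+ 2)%:E).
  exact: (measurableT_comp (measurable_sqr_tnth i)).
have mC := measurable_sqr_diff_tnth i.
have ba0 : 0 <= b / a by rewrite divr_ge0 ?ltW.
have ab0 : 0 <= a / b by rewrite divr_ge0 ?ltW.
have sqr0 (f : euclidean R m * euclidean R m -> R) p :
    setT p -> (0 <= (f p ^+ 2)%:E)%E.
  by rewrite lee_fin sqr_ge0.
have X0 := sqr0 (fun p => tnth p.1 i); have Y0 := sqr0 (fun p => tnth p.2 i).
have C0 := sqr0 (fun p => tnth p.1 i - tnth p.2 i).
have [mbX maY] := (measurable_funeM (b / a)%:E mX, measurable_funeM (a / b)%:E mY).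
have bX0 (p : euclidean R m * euclidean R m) :
    setT p -> (0 <= (b / a)%:E * (tnth p.1 i ^+ 2)%:E)%E.
  by move=> pT; rewrite mule_ge0 ?X0.
have aY0 (p : euclidean R m * euclidean R m) :
    setT p -> (0 <= (a / b)%:E * (tnth p.2 i ^+ 2)%:E)%E.
  by move=> pT; rewrite mule_ge0 ?Y0.
(* All terms stand on the side where they are nonnegative, so that no extended real is
   subtracted. *)
have : (X + Y <= (b / a)%:E * X + (a / b)%:E * Y + C)%E.
  rewrite -(ge0_integralZl_EFin gamma measurableT X0 mX ba0).
  rewrite -(ge0_integralZl_EFin gamma measurableT Y0 mY ab0).
  rewrite -(ge0_integralD gamma measurableT X0 mX Y0 mY).
  rewrite -(ge0_integralD gamma measurableT bX0 mbX aY0 maY).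
  rewrite -ge0_integralD//; last 2 first.
  - by move=> p pT; rewrite adde_ge0 ?bX0 ?aY0.
  - exact: emeasurable_funD.
  apply: ge0_le_integral => //.
  - by move=> p pT; rewrite adde_ge0 ?X0 ?Y0.
  - exact: emeasurable_funD.
  - by apply: emeasurable_funD => //; exact: emeasurable_funD.
  - move=> p _; rewrite -!EFinM -!EFinD lee_fin.
    rewrite -subr_ge0.
    rewrite [leRHS](_ : _ = (b * tnth p.1 i - a * tnth p.2 i) ^+ 2 / (a * b)).
      by rewrite divr_ge0 ?sqr_ge0// mulr_ge0 ?ltW.
    by field; rewrite !gt_eqF.
have : (0 <= C)%E by apply: integral_ge0 => p _; rewrite lee_fin sqr_ge0.
rewrite XE YE; case: C => [c _|_ _|//]; last exact: leey.
rewrite -!EFinM -!EFinD !lee_fin.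
(* Both weighted moments equal [a * b * M], which leaves
   [(a ^+ 2 + b ^+ 2 - 2 * a * b) * M <= c]. *)
have bX : b / a * (a ^+ 2 * M) = a * b * M by field; rewrite gt_eqF.
have aY : a / b * (b ^+ 2 * M) = a * b * M by field; rewrite gt_eqF.
by rewrite bX aY; lra.
Qed.

Lemma dilation_coupling_cost mu theta eta nu nu' :
  (forall i, 0 < theta i 0) -> (forall i, 0 < eta i 0) ->
  is_dilation mu theta nu -> is_dilation mu eta nu' ->
  exists2 gamma, coupling nu nu' gamma & transport_cost gamma =
    (\sum_i ((theta i 0 - eta i 0) ^+ 2)%:E * second_moment (marginal mu i))%E.
Proof.
move=> theta0 eta0 dil dil'.
(* Both components come from the same [x], so their [i]-th coordinates differ by
   [(theta i 0 - eta i 0) * tnth x i]. *)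
pose T (x : euclidean R m) := (dilate theta x, dilate eta x).
have mT : measurable_fun setT T.
  by apply/measurable_fun_pairP; split; exact: measurable_dilate.
pose Tm : {mfun euclidean R m >-> (euclidean R m * euclidean R m)%type} :=
  HB.pack T (isMeasurableFun.Build _ _ _ _ _ mT).
exists (distribution mu Tm).
  move=> A mA; rewrite (is_dilation_pushforward theta0 dil)//.
  by rewrite (is_dilation_pushforward eta0 dil').
rewrite transport_costE; apply: eq_bigr => i _.
rewrite second_moment_marginal /distribution ge0_integral_pushforward//=; last 2 first.
- exact: measurable_sqr_diff_tnth.
- by move=> x _; rewrite lee_fin sqr_ge0.
rewrite preimage_setT.
under eq_integral do rewrite !tnth_mktuple -mulrBl exprMn EFinM.
rewrite ge0_integralZl_EFin ?sqr_ge0//; last exact: measurable_sqr_tnth.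
by move=> x _; rewrite lee_fin sqr_ge0.
Qed.

Lemma wasserstein2_dilation mu theta eta nu nu' :
  (forall i, 0 < theta i 0) -> (forall i, 0 < eta i 0) ->
  finite_second_moment mu -> is_dilation mu theta nu -> is_dilation mu eta nu' ->
  wasserstein2 nu nu' = sqrte
    (\sum_i ((theta i 0 - eta i 0) ^+ 2)%:E * second_moment (marginal mu i))%E.
Proof.
move=> theta0 eta0 mu2 dil dil'; apply/eqP; rewrite eq_le; apply/andP; split.
  have [gamma gammaP <-] := dilation_coupling_cost theta0 eta0 dil dil'.
  by apply: ereal_inf_lbound; exists gamma.
apply: le_ereal_inf_tmp => _ [gamma gammaP <-].
have cost_ge0 : (0 <= transport_cost gamma)%E.
  by apply: integral_ge0 => p _; rewrite lee_fin sqr_ge0.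
rewrite lee_sqrt// transport_costE; apply: lee_sum => i _.
exact: dilation_coordinate_cost gammaP.
Qed.

Lemma sqr_fine_wasserstein2_dilation mu theta eta nu nu' :
  (forall i, 0 < theta i 0) -> (forall i, 0 < eta i 0) ->
  finite_second_moment mu -> is_dilation mu theta nu -> is_dilation mu eta nu' ->
  fine (wasserstein2 nu nu') ^+ 2 =
  \sum_i (theta i 0 - eta i 0) ^+ 2 * fine (second_moment (marginal mu i)).
Proof.
move=> theta0 eta0 mu2 dil dil'.
rewrite (wasserstein2_dilation theta0 eta0 mu2 dil dil').
rewrite (eq_bigr (fun i => ((theta i 0 - eta i 0) ^+ 2 *
    fine (second_moment (marginal mu i)))%:E)) => [|i _]; last first.
  by rewrite [RHS]EFinM fineK// second_moment_fin_num.
rewrite sumEFin /= sqr_sqrtr// sumr_ge0// => i _.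
rewrite mulr_ge0 ?sqr_ge0// fine_ge0// second_moment_marginal.
by apply: integral_ge0 => x _; rewrite lee_fin sqr_ge0.
Qed.

End Wasserstein.

Theorem theorem3p6 (R : realType) (m N : nat)
    (mu0 : probability (euclidean R m) R)
    (mu0_W2 : finite_second_moment mu0)
    (mu0_ac : mu0 `<< lebesgue_euclidean m)
    (Theta : set 'cV[R]_m)
    (Theta_pos : forall theta, Theta theta -> forall i, 0 < theta i 0)
    (theta : 'I_N -> 'cV[R]_m)
    (theta_in : forall i, Theta (theta i))
    (mu : 'I_N -> probability (euclidean R m) R)
    (mu_dil : forall i, is_dilation mu0 (theta i) (mu i)) :
  let S := diag_mx (\row_i Num.sqrt (fine (second_moment (marginal mu0 i)))) in
  wassmap_recovers mu (fun i => S *m theta i).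
Proof.
move=> S; apply: wassmap_recovers_sqdist.
have theta0 i := Theta_pos _ (theta_in i).
apply/matrixP => i j; rewrite !mxE.
rewrite (sqr_fine_wasserstein2_dilation (theta0 i) (theta0 j) mu0_W2
  (mu_dil i) (mu_dil j)).
(* The square of the [k]-th diagonal entry of [S] is the second moment weighting that coordinate. *)
apply: eq_bigr => k _; rewrite !mul_diag_mx !mxE -mulrBr exprMn mulrC sqr_sqrtr//.
rewrite fine_ge0// second_moment_marginal.
by apply: integral_ge0 => x _; rewrite lee_fin sqr_ge0.
Qed.
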